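(* Let $S$ be a set of triangles such that $Forb_c(S)$ is a prioritised semi-free amalgamation class with respect to the linearly ordered $\mathcal L'=\{R_1>\dots>R_m\}\subsetneq\mathcal L$, and suppose $S$ satisfies Condition ( * ). Let $G=\mathrm{Aut}(\mathcal M_S)$. Then for any $a,c\in\mathcal M_S$ and any finite $B\subseteq\mathcal M_S$, $\langle G_{(aB)},G_{(cB)}\rangle=G_{(B)}$. Consequently $\mathcal M_S$ has the intersection property, and thus weak elimination of imaginaries.
   Context: $\mathcal L$ is a language of binary relation symbols interpreted as symmetric irreflexive relations; a structure is complete if any two distinct elements $a,b$ are related by exactly one relation, denoted $\mathbf r(a,b)$. A triangle is a complete structure on three points, specified by the multiset of its edge relations. $Forb_c(S)$ is the class of finite complete structures embedding no triangle of $S$, assumed to be an amalgamation class; $\mathcal M_S$ is its Fraïssé limit (countable homogeneous structure with age $Forb_c(S)$). $AB$ denotes the substructure on $A\cup B$, $aB=\{a\}\cup B$; $G_{(A)}$ is the pointwise stabiliser of $A$. For $A,B,C\in Forb_c(S)$ with $B$ common substructure of $A,C$, $A\otimes_B C$ is the complete structure on the disjoint union of $A,C$ over $B$ extending both, with $\mathbf r(a,c)=R_i$ for $a\in A\setminus B$, $c\in C\setminus B$, where $i$ is least such that no $b\in B$ makes the triangle with edges $\mathbf r(a,b),\mathbf r(b,c),R_i$ lie in $S$ ($R_1$ if $B=\emptyset$). $Forb_c(S)$ is a prioritised semi-free amalgamation class if $A\otimes_B C$ is always defined and in $Forb_c(S)$. For finite $A,B,C\subseteq\mathcal M_S$, $A\mathrel{\perp\!\!\!\perp}_B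 C$ means the substructure on $A\cup B\cup C$ equals $AB\otimes_B BC$. Condition ( * ): (i) $S$ contains no triangle having two edges coloured $R_1,R_1$ or two edges coloured $R_1,R_2$; (ii) for all $a,b,c\in\mathcal M_S$ and finite $B\subseteq\mathcal M_S$, if $a\mathrel{\perp\!\!\!\perp}_{bB} c$ and $\mathbf r(a,b)\in\mathcal L'$, then $a\mathrel{\perp\!\!\!\perp}_B c$. A homogeneous structure $\mathcal M$ with $G=\mathrm{Aut}(\mathcal M)$ has the intersection property if $\langle G_{(A)},G_{(B)}\rangle=G_{(A\cap B)}$ for all finite $A,B\subseteq\mathcal M$. Weak elimination of imaginaries is the standard model-theoretic notion.
   Formalization: The first claim is stated for a ≠ c, since for a = c outside B it fails (the group generated is G_(aB), not G_(B)); Condition ( * )(ii) is assumed only for b ≠ c, since for c = b and B empty it would force r(a,b) = R_1 for every priority colour realised. *)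

(* Defs.v *)
From mathcomp Require Import all_boot finmap multiset.
From mathcomp Require Import boolp classical_sets cardinality.
From Stdlib Require Import RelationClasses.

Set Implicit Arguments.
Unset Strict Implicit.
Unset Printing Implicit Defensive.

Local Open Scope mset_scope.
Local Open Scope classical_set_scope.

(** * Structures in a language of symmetric irreflexive binary relations *)

Record structure (L : Type) := Structure {
  carrier :> Type;
  rel_of : L -> carrier -> carrier -> Prop;
  rel_sym : forall R x y, rel_of R x y -> rel_of R y x;
  rel_irrefl : forall R x, ~ rel_of R x x }.
Arguments rel_of {L M} R x y : rename.

Section Structures.
Context {L : Type}.
Implicit Types A M : structure L.

(* [rel_of R x y], for x <> y, then says r(x, y) = R. *)
Definition complete M :=
  forall x y : M, x <> y -> exists! R : L, rel_of R x y.

Definition embedding A M (f : A -> M) :=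
  injective f /\ forall R x y, rel_of R x y <-> rel_of R (f x) (f y).

Definition automorphism M (g : M -> M) := bijective g /\ embedding g.

Definition partial_iso M (X : set M) (f : M -> M) :=
  (forall x y, X x -> X y -> f x = f y -> x = y) /\
  (forall R x y, X x -> X y -> rel_of R x y <-> rel_of R (f x) (f y)).

Definition homogeneous M :=
  forall (X : set M) (f : M -> M), finite_set X -> partial_iso X f ->
    exists2 g : M -> M, automorphism g & forall x, X x -> g x = f x.

(** ** Subgroups of the automorphism group *)

Definition is_subgroup M (H : set (M -> M)) :=
  [/\ forall g, H g -> automorphism g,
      H id,
      forall g h, H g -> H h -> H (g \o h) &
      forall g h, H g -> cancel g h -> cancel h g -> H h].

Definition generated M (U : set (M -> M)) : set (M -> M) :=
  smallest (@is_subgroup M) U.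

Definition pstab M (X : set M) : set (M -> M) :=
  [set g | automorphism g /\ forall x, X x -> g x = x].

Definition intersection_property M :=
  forall X Y : set M, finite_set X -> finite_set Y ->
    generated (pstab X `|` pstab Y) = pstab (X `&` Y).

End Structures.

(** * Forbidden triangles *)

Section Triangles.
Context {L : choiceType}.
Implicit Types (S : set {mset L}) (pr : seq L) (A M : structure L).

(* A triangle is given by the multiset of its three edge colours. *)
Definition edges (p q r : L) : {mset L} := seq_mset [:: p; q; r].

Definition triangles S := forall t, S t -> size t = 3.

Definition omits S A :=
  forall (x y z : A) p q r, x <> y -> y <> z -> x <> z ->
    rel_of p x y -> rel_of q y z -> rel_of r x z -> ~ S (edges p q r).

Definition forb_c S A := [/\ finite_set [set: A], complete A & omits S A].

Definition fraisse_limit S M :=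
  [/\ countable [set: M], homogeneous M &
      forall A, forb_c S A <->
        finite_set [set: A] /\ exists f : A -> M, embedding f].

(** ** Prioritised semi-free amalgamation
    The priority order R_1 > ... > R_m is the list [pr] = [:: R_1; ...; R_m]. *)

Definition blocked S M (Y : set M) (a c : M) (R : L) :=
  exists b p q, [/\ Y b, rel_of p a b, rel_of q b c & S (edges p q R)].

Definition priority_colour S pr M (Y : set M) (a c : M) (R : L) :=
  exists i : nat, [/\ onth pr i = Some R, ~ blocked S Y a c R &
    forall (j : nat) R', j < i -> onth pr j = Some R' -> blocked S Y a c R'].

(* For subsets X, Z of a complete structure M, both containing Y: the
   substructure induced on [X `|` Z] is the amalgam of X and Z over Y. *)
Definition is_amalgam S pr M (X Y Z : set M) :=
  X `&` Z = Y /\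
  forall a c, (X `\` Y) a -> (Z `\` Y) c ->
    exists2 R, priority_colour S pr Y a c R & rel_of R a c.

(* The amalgam of A and C over B exists as a structure D of the class; the
   embeddings f, g make B a common substructure of A and C. *)
Definition prioritised_semi_free S pr :=
  forall (A B C : structure L) (f : B -> A) (g : B -> C),
    forb_c S A -> forb_c S B -> forb_c S C -> embedding f -> embedding g ->
    exists (D : structure L) (i : A -> D) (j : C -> D),
      [/\ forb_c S D, embedding i /\ embedding j, i \o f = j \o g,
          range i `|` range j = [set: D] &
          is_amalgam S pr (range i) (range (i \o f)) (range j)].

Definition indep S pr M (X Y Z : set M) :=
  is_amalgam S pr (X `|` Y) Y (Y `|` Z).

(* In the first part the clause on R_2 is void if there is only one priority
   colour.  In the second part b and c must be distinct: for c = b the premise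
   [indep {a} ({b} U Y) {b}] holds trivially, and the condition with Y empty
   would force r(a, b) = R_1 whenever r(a, b) is a priority colour. *)
Definition condition_star S pr M :=
  ((forall R1 R, onth pr 0 = Some R1 -> ~ S (edges R1 R1 R)) /\
   (forall R1 R2 R, onth pr 0 = Some R1 -> onth pr 1 = Some R2 ->
      ~ S (edges R1 R2 R))) /\
  (forall (a b c : M) (Y : set M), finite_set Y -> b <> c ->
     indep S pr [set a] (b |` Y) [set c] ->
     (exists2 R, R \in pr & rel_of R a b) ->
     indep S pr [set a] Y [set c]).

End Triangles.

(** * First-order logic and weak elimination of imaginaries *)

(* Formulas whose free variables are indexed by 'I_n; [FAll] binds variable 0
   and shifts the others. *)
Inductive formula (L : Type) : nat -> Type :=
| FFalse n : formula L n
| FEq n (x y : 'I_n) : formula L n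
| FRel n (R : L) (x y : 'I_n) : formula L n
| FImp n (phi psi : formula L n) : formula L n
| FAll n (phi : formula L n.+1) : formula L n.

Definition scons T n (a : T) (v : 'I_n -> T) : 'I_n.+1 -> T :=
  fun i => if unlift ord0 i is Some j then v j else a.

Fixpoint sat L (M : structure L) n (phi : formula L n) : ('I_n -> M) -> Prop :=
  match phi with
  | FFalse _ => fun=> False
  | FEq _ x y => fun v => v x = v y
  | FRel _ R x y => fun v => rel_of R (v x) (v y)
  | FImp _ phi psi => fun v => sat phi v -> sat psi v
  | FAll _ phi => fun v => forall a : M, sat phi (scons a v)
  end.

Definition join T m n (x : 'I_m -> T) (y : 'I_n -> T) : 'I_(m + n) -> T :=
  fun i => match fintype.split i with inl j => x j | inr k => y k end.

Section Imaginaries.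
Context {L : Type} (M : structure L).

Definition definable_equivalence n (E : ('I_n -> M) -> ('I_n -> M) -> Prop) :=
  Equivalence E /\
  exists phi : formula L (n + n), forall x y, E x y <-> sat phi (join x y).

(* The elements of the sort M^n / E of M^eq are the classes [E x]; a relation
   between k-tuples of M and elements of that sort is definable in M^eq without
   parameters iff its pullback to M^(k + n) is so in M. *)
Definition definable_eq n (E : ('I_n -> M) -> ('I_n -> M) -> Prop) k
    (P : ('I_k -> M) -> set ('I_n -> M) -> Prop) :=
  exists phi : formula L (k + n),
    forall z x, P z (E x) <-> sat phi (join z x).

(* [E x] is in the definable closure in M^eq of the real tuple c. *)
Definition in_dcl_eq n (E : ('I_n -> M) -> ('I_n -> M) -> Prop) x
    k (c : 'I_k -> M) :=
  exists2 P, definable_eq E P &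
    P c (E x) /\ forall y, P c (E y) -> E y = E x.

(* The real tuple c is in the algebraic closure in M^eq of [E x]. *)
Definition in_acl_eq n (E : ('I_n -> M) -> ('I_n -> M) -> Prop) x
    k (c : 'I_k -> M) :=
  exists2 P, definable_eq E P &
    P c (E x) /\ finite_set [set c' : 'I_k -> M | P c' (E x)].

Definition weak_elimination_of_imaginaries :=
  forall n (E : ('I_n -> M) -> ('I_n -> M) -> Prop), definable_equivalence E ->
  forall x : 'I_n -> M,
    exists k (c : 'I_k -> M), in_dcl_eq E x c /\ in_acl_eq E x c.

End Imaginaries.

(* Main.v *)
(** Let H be generated by the stabilisers of aB and cB, with a, c not in B.
    Conjugating one stabiliser by an element of the other, we may replace c by
    a copy of a that is free from a over cB, hence assume that r(a, c) is a
    priority colour.  Then a copy a' of a, free from a over cB, lies in the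
    H-orbit of a and, by the second part of Condition (star), is free from a
    over B.  All copies of a over B that are free from a over B have the same
    colour to a, so they all lie in that orbit; any two copies of a over B are
    linked by one that is free from both, so H is transitive on them.  Dropping
    points one at a time then gives the intersection property.

    For weak elimination, take X minimal such that the pointwise stabiliser of X
    fixes the class e of x.  By the intersection property the stabiliser of e
    preserves X setwise.  If c enumerates X, the type of (c, x), which is
    isolated by a quantifier-free formula even when the language is infinite,
    defines e from c and c up to finitely many conjugates from e. *)

Require Import Defs.
From mathcomp Require Import all_boot finmap multiset.
From mathcomp Require Import boolp classical_sets cardinality.

Local Open Scope mset_scope.
Local Open Scope classical_set_scope.

Set Implicit Arguments.
Unset Strict Implicit.
Unset Printing Implicit Defensive.

(** * Finite sets *)

Lemma finite_set_enum T (X : set T) :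
  finite_set X -> exists n (c : 'I_n -> T), X = range c.
Proof.
move=> /(@finite_seqP {classic T})[s ->].
exists (size s), (tnth (in_tuple s)); apply/seteqP; split=> x /=.
  by move=> /(tnthP (in_tuple s))[i ->]; exists i.
by move=> [i _ <-]; apply: mem_tnth.
Qed.

(** Induction on the length of a list of points covering [X]. If [X] is not minimal, some smaller
    [Z] with [P Z] misses a point [c i], and the list without index [i] still covers [Z]. *)
Lemma minimal_subset T (P : set T -> Prop) (X : set T) :
  finite_set X -> P X ->
  exists Y, [/\ Y `<=` X, P Y & forall Z, Z `<=` Y -> P Z -> Z = Y].
Proof.
move=> /finite_set_enum[n [c Xc]] PX.
have {Xc} : X `<=` range c by rewrite Xc.
elim: n => [|n IHn] in c X PX *; move=> Xc.
  exists X; split=> // Z ZX _; apply/seteqP; split=> // x /Xc[i].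
  by have := ltn_ord i; rewrite ltn0.
have [Xmin|] := pselect (forall Z, Z `<=` X -> P Z -> Z = X).
  by exists X; split.
move=> /existsNP[Z] /not_implyP[ZX] /not_implyP[PZ ZneX].
have [x Xx nZx] : exists2 x, X x & ~ Z x.
  apply: contrapT => /forall2NP XZ; apply: ZneX; apply/seteqP; split=> // x Xx.
  by have [|/contrapT] := XZ x.
have [i _ ci] := Xc _ Xx.
have Zc : Z `<=` range (c \o lift i).
  move=> z Zz; have [j _ cj] := Xc _ (ZX _ Zz).
  case: (unliftP i j) => [k jE|jE]; first by exists k; rewrite //= -jE.
  by case: nZx; rewrite -ci -jE cj.
have [Y [YZ PY Ymin]] := IHn _ _ PZ Zc.
by exists Y; split=> //; apply: subset_trans ZX.
Qed.

(** * Automorphisms and pointwise stabilisers *)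

Section Automorphisms.
Context {L : Type} (M : structure L).
Implicit Types (X Y Z : set M) (H : set (M -> M)).

Lemma automorphism_id : automorphism (@id M).
Proof. by split; [exists id|split]. Qed.

Lemma automorphism_comp (g h : M -> M) :
  automorphism g -> automorphism h -> automorphism (g \o h).
Proof.
move=> [bg [ig rg]] [bh [ih rh]]; split; first exact: bij_comp.
by split; [exact: inj_comp|move=> R x y; rewrite rh rg].
Qed.

Lemma automorphism_can (g h : M -> M) :
  automorphism g -> cancel g h -> cancel h g -> automorphism h.
Proof.
move=> [_ [_ rg]] gK hK; split; first by exists g.
by split; [exact: can_inj hK|move=> R x y; rewrite (rg R (h x)) !hK].
Qed.

Lemma automorphism_inv (g : M -> M) : automorphism g ->
  exists h, [/\ automorphism h, cancel g h & cancel h g].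
Proof.
move=> ag; have [[h gK hK] _] := ag.
by exists h; split=> //; apply: automorphism_can ag gK hK.
Qed.

Lemma rel_automorphism (g : M -> M) R x y :
  automorphism g -> rel_of R (g x) (g y) <-> rel_of R x y.
Proof. by move=> [_ [_ rg]]; rewrite -rg. Qed.

Lemma pstab_subgroup X : is_subgroup (pstab X).
Proof.
split=> [g []//||g h [ag fg] [ah fh]|g h [ag fg] gK hK].
- by split=> //; apply: automorphism_id.
- by split=> [|x Xx /=]; [apply: automorphism_comp|rewrite fh// fg].
- split; first exact: automorphism_can ag gK hK.
  by move=> x Xx; rewrite -{1}(fg x Xx) gK.
Qed.

Lemma pstabS X Y : X `<=` Y -> pstab Y `<=` pstab X.
Proof. by move=> XY g [ag fg]; split=> // x /XY /fg. Qed.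

Lemma pstab_notin X g a : pstab X g -> ~ X a -> ~ X (g a).
Proof.
move=> [[_ [ig _]] fg] nXa Xga; apply: nXa.
by have /ig <- := fg _ Xga.
Qed.

(** The quotient $u^{-1}f$ fixes [a] and [X], hence lies in [H]. So whether an element of [pstab X]
    is in [H] depends only on where it sends [a]. *)
Lemma subgroup_orbit H X a f u : is_subgroup H -> pstab (a |` X) `<=` H ->
  pstab X f -> pstab X u -> H u -> f a = u a -> H f.
Proof.
move=> [_ _ Hc _] aH [af ff] [au fu] Hu fua.
have [v [av uK vK]] := automorphism_inv au.
have -> : f = u \o (v \o f) by apply/funext => x /=; rewrite vK.
apply: Hc => //; apply: aH; split; first exact: automorphism_comp.
move=> x [->|Xx] /=; first by rewrite fua uK.
by rewrite ff// -{1}(fu x Xx) uK.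
Qed.

(** The stabiliser of $gX$ is the conjugate $g G_{(X)} g^{-1}$. *)
Lemma pstab_image H X g : is_subgroup H -> H g -> pstab X `<=` H ->
  pstab (g @` X) `<=` H.
Proof.
move=> [Ha _ Hc Hi] Hg XH f [af ff]; have ag := Ha _ Hg.
have [h [ah gK hK]] := automorphism_inv ag.
have -> : f = g \o ((h \o f \o g) \o h).
  by apply/funext => x /=; rewrite !hK.
apply: (Hc _ _ Hg); apply: Hc; last exact: Hi Hg gK hK.
apply: XH; split; first by do !apply: automorphism_comp => //.
by move=> x Xx /=; rewrite ff ?gK//; exists x.
Qed.

Lemma generated_subgroup (U : set (M -> M)) :
  (forall g, U g -> automorphism g) -> is_subgroup (generated U).
Proof.
move=> Uaut; split.
- move=> g /(_ (@automorphism L M)); apply; split=> //; split=> [//||g1 g2|g1 g2].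
  + exact: automorphism_id.
  + exact: automorphism_comp.
  + exact: automorphism_can.
- by move=> H [[]].
- by move=> g h Ug Uh H HU; have [[_ _ Hc _] _] := HU; apply: Hc; [apply: Ug|apply: Uh].
- move=> g h Ug gK hK H HU; have [[_ _ _ Hi] _] := HU.
  by apply: Hi gK hK; apply: Ug.
Qed.

(** Replaces the generated group by an arbitrary subgroup [H] containing both stabilisers, the form
    in which the later arguments are run. *)
Lemma generated_pstab_eq X Y Z : Z `<=` X -> Z `<=` Y ->
  (forall H, is_subgroup H -> pstab X `<=` H -> pstab Y `<=` H ->
     pstab Z `<=` H) ->
  generated (pstab X `|` pstab Y) = pstab Z.
Proof.
move=> ZX ZY gen; apply/seteqP; split.
  apply: smallest_sub; first exact: pstab_subgroup.
  by rewrite subUset; split; apply: pstabS.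
have sub : pstab X `|` pstab Y `<=` generated (pstab X `|` pstab Y).
  exact: sub_gen_smallest.
apply: gen.
- by apply: generated_subgroup => g [] [].
- by move=> g Xg; apply: sub; left.
- by move=> g Yg; apply: sub; right.
Qed.

(** * From dropping one point to intersecting finite sets *)

Section Intersection.
Variable H : set (M -> M).
Hypothesis stepH : forall (a c : M) X, finite_set X -> a <> c ->
  pstab (a |` X) `<=` H -> pstab (c |` X) `<=` H -> pstab X `<=` H.

Let listed (l : seq M) : set M := foldr (fun a X => a |` X) set0 l.

Let listed_finite l : finite_set (listed l).
Proof. by elim: l => //= a l IHl; rewrite finite_setU; split. Qed.

Let finite_listed X : finite_set X -> exists l, X = listed l.
Proof.
move=> /(@finite_seqP {classic M})[s ->]; exists s.
apply/seteqP; split; elim: s => //= a s IHs x.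
  by move=> /predU1P[->|/IHs]; [left|right].
by move=> [->|/IHs ?]; apply/predU1P; [left|right].
Qed.

Let sub_pstab X Y : X `<=` Y -> pstab X `<=` H -> pstab Y `<=` H.
Proof. by move=> XY; apply: subset_trans; apply: pstabS. Qed.

(** The points [c] of [Y] are removed one at a time with [stepH], whose other input always comes
    from the stabiliser of [a] and [X]. That [a] is not in [Y] keeps [a] and [c] distinct. *)
Let drop_point a X Y : finite_set X -> finite_set Y -> ~ Y a ->
  pstab (a |` X) `<=` H -> pstab (Y `|` X) `<=` H -> pstab X `<=` H.
Proof.
move=> fX /finite_listed[l ->]; elim: l => [|c l IHl] nla aH.
  by rewrite set0U.
rewrite /= -setUA => lH; apply: IHl => //; first by move=> la; apply: nla; right.
apply: (stepH (a := a)) lH; first by rewrite finite_setU; split.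
  by move=> ac; apply: nla; left; exact: ac.
by apply: sub_pstab aH => x [|Xx]; [left|right; right].
Qed.

Lemma pstab_setI X Y : finite_set X -> finite_set Y ->
  pstab X `<=` H -> pstab Y `<=` H -> pstab (X `&` Y) `<=` H.
Proof.
move=> fX fY XH YH; set Z := X `&` Y.
have fZ : finite_set Z by apply: sub_finite_set fX => x [].
have [l lX] := finite_listed fX.
have {XH} : pstab (listed l `|` Z) `<=` H by apply: sub_pstab XH; rewrite lX; left.
have : listed l `&` Y `<=` Z by rewrite -lX.
elim: l {lX} => [|a l IHl] lYZ; first by rewrite set0U.
rewrite /= -setUA => lH.
apply: IHl => [x [lx Yx]|]; first by apply: lYZ; split=> //; right.
have [Ya|nYa] := pselect (Y a).
  by apply: sub_pstab lH => x [->|//]; right; apply: lYZ; split=> //; left.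
apply: (@drop_point a _ Y) => //; first by rewrite finite_setU; split.
by apply: sub_pstab YH; left.
Qed.

End Intersection.
End Automorphisms.

(** * Consequences of homogeneity *)

Definition same_qf_type L (M : structure L) I (v w : I -> M) := forall i j,
  (v i = v j <-> w i = w j) /\
  forall R, rel_of R (v i) (v j) <-> rel_of R (w i) (w j).

Section Homogeneity.
Context {L : Type} (M : structure L).
Hypothesis M_homogeneous : homogeneous M.

(** The family may repeat values: agreement on equalities makes the map from [w i] to [w' i] well
    defined and injective. *)
Lemma homogeneous_family I (w w' : I -> M) : finite_set (range w) ->
  same_qf_type w w' -> exists2 g, automorphism g & forall i, g (w i) = w' i.
Proof.
move=> fw ww'.
have /choice[f fE] : forall x : M, exists y, forall i, w i = x -> y = w' i.
  move=> x; have [[i wi]|nx] := pselect (exists i, w i = x).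
    by exists (w' i) => j wj; apply/(ww' i j).1; rewrite wi wj.
  by exists x => i wi; case: nx; exists i.
have fw' i : f (w i) = w' i by apply: fE.
have [|g ag gf] := @M_homogeneous (range w) f fw.
  split=> [x y [i _ <-] [j _ <-]|R x y [i _ <-] [j _ <-]]; rewrite !fw'.
    by move=> /(ww' i j).1.
  exact: (ww' i j).2.
by exists g => // i; rewrite gf ?fw'//; exists i.
Qed.

Lemma homogeneous_point (Y : set M) (u v : M) : finite_set Y ->
  ~ Y u -> ~ Y v ->
  (forall R y, Y y -> rel_of R u y <-> rel_of R v y) ->
  exists2 g, pstab Y g & g u = v.
Proof.
move=> fY nYu nYv uv.
pose f x := if asbool (x = u) then v else x.
have fu : f u = v by rewrite /f asboolT.
have fY' y : Y y -> f y = y.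
  by move=> Yy; rewrite /f asboolF// => yu; apply: nYu; rewrite -yu.
have [||g ag gf] := @M_homogeneous (u |` Y) f.
- by rewrite finite_setU; split.
- split=> [x y|R x y].
    move=> [->|Yx] [->|Yy]; rewrite ?fu ?fY'// => vy; exfalso.
      by apply: nYv; rewrite vy.
    by apply: nYv; rewrite -vy.
  move=> [->|Yx] [->|Yy]; rewrite ?fu ?fY'//.
  - by split=> h; case: (rel_irrefl h).
  - exact: uv.
  - by split=> h; apply: rel_sym; apply/(uv _ _ Yx); apply: rel_sym.
exists g; last by rewrite gf ?fu//; left.
by split=> // y Yy; rewrite gf ?fY'//; right.
Qed.

End Homogeneity.

(** * Induced substructures *)

Section Substructures.
Context {L : Type} (M : structure L).

Definition induced (X : set M) : structure L := {|
  carrier := {x : M | X x};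
  rel_of := fun R x y => rel_of R (sval x) (sval y);
  rel_sym := fun R x y => @rel_sym L M R (sval x) (sval y);
  rel_irrefl := fun R x => @rel_irrefl L M R (sval x) |}.

Lemma induced_embedding X : embedding (sval : induced X -> M).
Proof. by split=> // -[x Xx] [y Xy]; apply: eq_exist. Qed.

Lemma induced_finite X : finite_set X -> finite_set [set: induced X].
Proof.
move=> /finite_set_enum[n [c Xc]].
have cX i : X (c i) by rewrite Xc; exists i.
apply: (@sub_finite_set _ _ (range (fun i => exist X (c i) (cX i) : induced X))).
  move=> [x Xx] _; have := Xx; rewrite {1}Xc => -[i _ ci].
  by exists i => //; apply: (induced_embedding X).1.
exact: finite_image.
Qed.

Definition inclusion (X Y : set M) (XY : X `<=` Y) (x : induced X) : induced Y :=
  exist Y (sval x) (XY _ (svalP x)).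

Lemma inclusion_embedding X Y (XY : X `<=` Y) : embedding (inclusion XY).
Proof.
by split=> // x y /(congr1 sval) /=; apply: (induced_embedding X).1.
Qed.

End Substructures.

(** * Blocked colours and priority colours *)

Section Colours.
Context {L : choiceType} (S : set {mset L}) (pr : seq L).

Lemma blocked_embedding (D M : structure L) (e : D -> M) Y a c R :
  embedding e -> blocked S (e @` Y) (e a) (e c) R <-> blocked S Y a c R.
Proof.
move=> [_ re]; split=> -[b [p [q [Yb ab bc SR]]]].
  have [b' Yb' bE] := Yb; rewrite -bE in ab bc.
  by exists b', p, q; split=> //; apply/re.
by exists (e b), p, q; split=> //; apply/re.
Qed.

(** Blocking sees [a] and [c] only through their separate relations to [Y], so [g] and [h] may
    differ. Hence free pairs of copies of [a] over [Y] all have the same colour. *)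
Lemma blocked_pstab (M : structure L) (Y : set M) g h a c R :
  pstab Y g -> pstab Y h ->
  blocked S Y (g a) (h c) R <-> blocked S Y a c R.
Proof.
move=> [ag fg] [ah fh].
split=> -[b [p [q [Yb ab bc SR]]]]; exists b, p, q; split=> //.
- by apply/(rel_automorphism p a b ag); rewrite (fg b).
- by apply/(rel_automorphism q b c ah); rewrite (fh b).
- by rewrite -(fg b)//; apply/rel_automorphism.
- by rewrite -(fh b)//; apply/rel_automorphism.
Qed.

Lemma priority_colour_congr (M N : structure L) (Y : set M) (Z : set N) a c u v R :
  (forall Q, blocked S Y a c Q <-> blocked S Z u v Q) ->
  priority_colour S pr Y a c R -> priority_colour S pr Z u v R.
Proof.
move=> YZ [i [iR nb lb]]; exists i; split=> //; first by rewrite -YZ.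
by move=> j R' ji /lb; rewrite YZ; apply.
Qed.

Lemma priority_colour_uniq (M : structure L) (Y : set M) a c R R' :
  priority_colour S pr Y a c R -> priority_colour S pr Y a c R' -> R = R'.
Proof.
move=> [i [iR nb lb]] [j [jR nb' lb']].
case: (ltngtP i j) => [ij|ji|ij].
- by case: nb; apply: lb' ij iR.
- by case: nb'; apply: lb ji jR.
- by move: jR; rewrite -ij iR => -[].
Qed.

Lemma priority_colour_mem (M : structure L) (Y : set M) a c R :
  priority_colour S pr Y a c R -> R \in pr.
Proof. by move=> [i [iR _ _]]; apply/onthP; exists i. Qed.

Lemma indep_colour (M : structure L) (Y Z : set M) u z :
  indep S pr [set u] Y Z -> ~ Y u -> ~ Y z -> Z z ->
  exists R, [/\ priority_colour S pr Y u z R, rel_of R u z & u <> z].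
Proof.
move=> [_ amal] nYu nYz Zz.
have [||R uz Ruz] := amal u z.
- by split=> //; left.
- by split=> //; right.
by exists R; split=> // uzE; apply: (rel_irrefl (R := R) (x := z)); rewrite -{1}uzE.
Qed.

End Colours.

(** * Free extensions and stabilisers in the Fraïssé limit *)

Section Limit.
Context {L : choiceType} (S : set {mset L}) (pr : seq L) (M : structure L).
Hypothesis S_psf : prioritised_semi_free S pr.
Hypothesis M_limit : fraisse_limit S M.

Let M_homogeneous : homogeneous M. Proof. by case: M_limit. Qed.

Lemma induced_forb_c (X : set M) : finite_set X -> forb_c S (induced X).
Proof.
move=> fX; have [_ _ age] := M_limit; apply/age; split.
  exact: induced_finite.
by exists sval; apply: induced_embedding.
Qed.

Lemma limit_complete : complete M.
Proof.
move=> x y xy; pose X := [set x; y] : set M.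
have [|_ cX _] := @induced_forb_c X; first by rewrite finite_setU; split.
have [|R [/= xyR uR]] := cX (exist X x (or_introl erefl)) (exist X y (or_intror erefl)).
  by move=> /(congr1 sval).
by exists R; split.
Qed.

Lemma limit_colour_uniq (x y : M) Q R : rel_of Q x y -> rel_of R x y -> Q = R.
Proof.
move=> xyQ xyR; have xy : x <> y.
  by move=> xy; apply: (rel_irrefl (R := Q) (x := y)); rewrite -{1}xy.
by have [T [_ uT]] := limit_complete xy; rewrite -(uT Q)// -(uT R).
Qed.

(** Amalgamate $aY$ and $YZ$ over $Y$ abstractly, embed the amalgam [D] into [M], and use
    homogeneity twice to put the copy of $YZ$ back in place and to move [a] into the copy of
    $aY$. *)
Lemma free_extension (a : M) (Y Z : set M) : finite_set Y -> finite_set Z ->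
  exists2 g, pstab Y g & indep S pr [set g a] Y Z.
Proof.
move=> fY fZ.
have YaY : Y `<=` [set a] `|` Y by right.
have YYZ : Y `<=` Y `|` Z by left.
have faY : finite_set ([set a] `|` Y) by rewrite finite_setU; split.
have fYZ : finite_set (Y `|` Z) by rewrite finite_setU.
have [D [i [j [Dforb [ei ej] ij _ [capD amalD]]]]] :=
  S_psf (induced_forb_c faY) (induced_forb_c fY) (induced_forb_c fYZ)
        (inclusion_embedding YaY) (inclusion_embedding YYZ).
have [_ _ age] := M_limit.
have [_ [h eh]] := (age D).1 Dforb.
have emb_comp (A B C : structure L) (p : B -> C) (q : A -> B) :
    embedding p -> embedding q -> embedding (p \o q).
  move=> [ip rp] [iq rq]; split; first exact: inj_comp.
  by move=> R x y; rewrite rq rp.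
have emb_family (A : structure L) (p q : A -> M) : finite_set [set: A] ->
    embedding p -> embedding q -> exists2 g, automorphism g & forall x, g (p x) = q x.
  move=> fA [ip rp] [iq rq]; apply: homogeneous_family => //.
    exact: finite_image.
  by move=> x y; split=> [|R]; [split=> [/ip|/iq] ->|rewrite -rp -rq].
(* [k] moves the copy of $YZ$ back onto $YZ$, so that [e] below is the identity on it. *)
have [k ak kE] := emb_family (induced (Y `|` Z)) (h \o j) sval (induced_finite fYZ)
  (emb_comp _ _ _ _ _ eh ej) (induced_embedding _).
pose e := k \o h; have ee : embedding e.
  by apply: emb_comp eh; case: ak.
(* [g] carries $aY$ to its copy under [e]. On [Y] it is the identity, because [i] and [j] agree
   there. *)
have [g ag gE] := emb_family (induced ([set a] `|` Y)) sval (e \o i) (induced_finite faY)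
  (induced_embedding _) (emb_comp _ _ _ _ _ ee ei).
have ejE z : e (j z) = sval z by apply: kE.
pose incY := inclusion YaY.
have eiY y : e (i (incY y)) = sval y.
  by have /= := congr1 (fun f => f y) ij; rewrite /incY => ->; rewrite ejE.
have gY y : Y y -> g y = y.
  by move=> Yy; apply: etrans (gE (incY (exist Y y Yy))) (eiY _).
pose a0 : induced ([set a] `|` Y) := exist _ a (or_introl erefl).
have ga : g a = e (i a0) by rewrite -[a in LHS]/(sval a0) gE.
have rangeY : e @` range (i \o incY) = Y.
  apply/seteqP; split=> [_ [_ [y _ <-] <-]|y Yy]; first by rewrite /= eiY; apply: (svalP y).
  by exists (i (incY (exist Y y Yy))); [exists (exist Y y Yy)|rewrite eiY].
exists g => //; split.
  apply/seteqP; split=> [x [[->|//]]|y Yy]; last by split; [right|left].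
  (* If [g a] falls into $YZ$, then [i a0] lies in both ranges, hence in the part of [D] amalgamated
     over, which [e] maps onto [Y]. *)
  rewrite ga => YZx; pose z : induced (Y `|` Z) := exist _ _ YZx.
  have iz : i a0 = j z by apply: ee.1; rewrite ejE.
  rewrite -rangeY; exists (i a0) => //; rewrite -capD; split; first by exists a0.
  by rewrite iz; exists z.
move=> _ z [[->|//]] nYga [YZz nYz].
pose z0 : induced (Y `|` Z) := exist _ z YZz.
have [||R pR aR] := amalD (i a0) (j z0).
- split; first by exists a0.
  by move=> rY; apply: nYga; rewrite ga -rangeY; exists (i a0).
- split; first by exists z0.
  by move=> rY; apply: nYz; rewrite -rangeY; exists (j z0) => //; rewrite ejE.
exists R; last by rewrite ga -[z]/(sval z0) -ejE; apply/ee.2.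
apply: priority_colour_congr pR => Q.
by rewrite -(blocked_embedding _ _ _ _ _ ee) rangeY ejE ga.
Qed.

Hypothesis S_star : condition_star S pr M.

Lemma pstab_subU1 H (a c : M) (Y : set M) : is_subgroup H -> finite_set Y ->
  a <> c -> pstab (a |` Y) `<=` H -> pstab (c |` Y) `<=` H -> pstab Y `<=` H.
Proof.
move=> sH fY ac aH cH.
have [Ya|nYa] := pselect (Y a).
  by apply: subset_trans aH; apply: pstabS => x [->|].
have [Yc|nYc] := pselect (Y c).
  by apply: subset_trans cH; apply: pstabS => x [->|].
have fU x : finite_set ([set x] `|` Y) by rewrite finite_setU; split.
have YU x : Y `<=` x |` Y by right.
have idY : pstab Y id by case: (pstab_subgroup Y).
have colour_aa g h R : pstab Y g -> pstab Y h ->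
    priority_colour S pr Y (g a) (h a) R -> priority_colour S pr Y a a R.
  by move=> sg sh; apply: priority_colour_congr => Q; apply: blocked_pstab.
(* The colour R depends on the type of a over Y only, not on b. *)
have key b : ~ Y b -> a <> b -> pstab (b |` Y) `<=` H ->
    (exists2 R, R \in pr & rel_of R a b) ->
    exists2 R, priority_colour S pr Y a a R &
      forall f, pstab Y f -> rel_of R (f a) a -> H f.
  move=> nYb ab bH [Q Qpr Qab].
  (* [g a] is free from [a] over $bY$. As [g] fixes [b], the colour of [g a] to [b] is still a
     priority colour, and the second part of the condition removes [b] from the base. *)
  have [g sg] := free_extension a (fU b) (finite_set1 a).
  have sgY := pstabS (YU b) sg.
  move=> /(S_star.2 _ _ _ _ fY (nesym ab))[].
    by exists Q => //; rewrite -(sg.2 b) ?rel_automorphism//; [case: sg|left].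
  move=> gaa_cap gaa_amal.
  have [R [pR gaaR gaa]] := indep_colour (conj gaa_cap gaa_amal)
    (pstab_notin sgY nYa) nYa erefl.
  exists R; first exact: (colour_aa g id).
  move=> f sf faR.
  (* [g a] and [f a] have the same relations to $aY$, so some [h] fixing $aY$ takes one to the
     other. Both [h] and [g] are in [H], and $hg$ agrees with [f] at [a]. *)
  have [|||h sh hga] := homogeneous_point M_homogeneous (fU a) (u := g a) (v := f a).
  - by move=> [//|]; apply: pstab_notin sgY nYa.
  - move=> [fa|]; last exact: pstab_notin sf nYa.
    by move: faR; rewrite fa => h; case: (rel_irrefl h).
  - move=> T y [->|Yy].
      by split=> [/(limit_colour_uniq gaaR)|/(limit_colour_uniq faR)] <-.
    have fixed_rel u : pstab Y u -> rel_of T (u a) y <-> rel_of T a y.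
      by move=> [au fu]; rewrite -{1}(fu y Yy) rel_automorphism.
    by rewrite (fixed_rel g sgY) (fixed_rel f sf).
  have [_ _ Hc _] := sH.
  apply: (subgroup_orbit sH aH sf (u := h \o g)) => //.
    by have [_ _ Yc _] := pstab_subgroup Y; apply: Yc => //; apply: pstabS sh.
  by apply: Hc; [apply: aH|apply: bH].
(* The conjugate [g a] will play the role of [b] in [key]: its colour to [a] is a priority colour by
   freeness over $cY$, and conjugating by [g], which lies in [H], puts the stabiliser of [g a] and
   [Y] inside [H]. *)
have [g sg ind] := free_extension a (fU c) (finite_set1 a).
have sgY := pstabS (YU c) sg.
have ncYa : ~ (c |` Y) a by move=> [/ac|].
have [R0 [pR0 gaR0 gaa]] := indep_colour ind (pstab_notin sg ncYa) ncYa erefl.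
have [||||R pR RH] := key (g a).
- exact: pstab_notin sgY nYa.
- exact: nesym.
- apply: subset_trans (pstab_image sH (cH _ sg) aH); apply: pstabS.
  by move=> _ [y [->|Yy] <-]; [left|right; rewrite sgY.2].
- by exists R0; [apply: priority_colour_mem pR0|apply: rel_sym].
move=> f sf.
have fa2 : finite_set [set a; f a] by rewrite finite_setU; split.
(* [k a] is free from both [a] and [f a] over [Y], so both colours are [R]. Then [key] applies to
   [k] and, after pulling back by [f], to $f^{-1}k$; finally $f = k(f^{-1}k)^{-1}$. *)
have [k sk kind] := free_extension a fY fa2.
have nYka := pstab_notin sk nYa.
have [R1 [pR1 kaR1 _]] := indep_colour kind nYka nYa (or_introl erefl).
have [R2 [pR2 kaR2 _]] :=
  indep_colour kind nYka (pstab_notin sf nYa) (or_intror erefl).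
have R1E : R1 = R by apply: priority_colour_uniq pR; apply: colour_aa pR1.
have R2E : R2 = R by apply: priority_colour_uniq pR; apply: colour_aa pR2.
have [h [ah fK hK]] := automorphism_inv sf.1.
have [l [al kK lK]] := automorphism_inv sk.1.
have [_ _ Yc Yi] := pstab_subgroup Y.
have sh : pstab Y h by apply: Yi sf fK hK.
have Hk : H k by apply: RH; rewrite -?R1E.
have Hhk : H (h \o k).
  apply: RH; first exact: Yc.
  by rewrite -{2}(fK a) /= rel_automorphism// -R2E.
have [_ _ Hc Hi] := sH.
have -> : f = k \o (l \o f) by apply/funext => x /=; rewrite lK.
apply: Hc => //; apply: Hi Hhk _ _ => x /=; first by rewrite hK kK.
by rewrite lK fK.
Qed.

Lemma limit_pstab_setI H (X Y : set M) : is_subgroup H ->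
  finite_set X -> finite_set Y ->
  pstab X `<=` H -> pstab Y `<=` H -> pstab (X `&` Y) `<=` H.
Proof. by move=> sH; apply: pstab_setI => a c Z; apply: pstab_subU1. Qed.

End Limit.

(** * Satisfaction, renaming and quantifier blocks *)

Section Formulas.
Context {L : Type} (M : structure L).

Lemma scons0 T n a (v : 'I_n -> T) : scons a v ord0 = a.
Proof. by rewrite /scons unlift_none. Qed.

Lemma scons_lift T n a (v : 'I_n -> T) i : scons a v (lift ord0 i) = v i.
Proof. by rewrite /scons liftK. Qed.

Lemma scons_comp T U (f : T -> U) n a (v : 'I_n -> T) :
  f \o scons a v = scons (f a) (f \o v).
Proof. by apply/funext => i; rewrite /scons /=; case: unlift. Qed.

Lemma join_comp T U (f : T -> U) m n (x : 'I_m -> T) (y : 'I_n -> T) :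
  f \o join x y = join (f \o x) (f \o y).
Proof. by apply/funext => i; rewrite /join /=; case: fintype.split. Qed.

Lemma join_lshift T m n (x : 'I_m -> T) (y : 'I_n -> T) i :
  join x y (lshift n i) = x i.
Proof. by rewrite /join (unsplitK (inl i)). Qed.

Lemma join_rshift T m n (x : 'I_m -> T) (y : 'I_n -> T) i :
  join x y (rshift m i) = y i.
Proof. by rewrite /join (unsplitK (inr i)). Qed.

Lemma scons_join T m n a (x : 'I_m -> T) (y : 'I_n -> T) :
  scons a (join x y) = join (scons a x) y :> ('I_(m.+1 + n) -> T).
Proof.
apply/funext => i; case: (unliftP ord0 i) => [j ->|->]; last first.
  rewrite scons0 (_ : ord0 = lshift n (@ord0 m)); last exact: val_inj.
  by rewrite join_lshift scons0.
rewrite scons_lift; case: (split_ordP j) => l ->.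
  rewrite (_ : lift ord0 _ = lshift n (lift ord0 l)); last exact: val_inj.
  by rewrite !join_lshift scons_lift.
rewrite (_ : lift ord0 _ = rshift m.+1 l); last exact: val_inj.
by rewrite !join_rshift.
Qed.

Lemma sat_automorphism (g : M -> M) n (phi : formula L n) (v : 'I_n -> M) :
  automorphism g -> sat phi v <-> sat phi (g \o v).
Proof.
move=> ag; elim: phi v => {n} [n|n i j|n R i j|n phi IHphi psi IHpsi|n phi IHphi] v //=.
- by split=> [->//|]; apply: ag.2.1.
- by rewrite rel_automorphism.
- by rewrite IHphi IHpsi.
- have [h [_ _ hK]] := automorphism_inv ag.
  split=> phiv a; last by apply/IHphi; rewrite scons_comp.
  by rewrite -(hK a) -scons_comp -IHphi.
Qed.

(** Under a quantifier the bound variable 0 is kept and the renaming of the others is shifted. *)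
Fixpoint rename m (phi : formula L m) : forall n, ('I_m -> 'I_n) -> formula L n :=
  match phi with
  | FFalse _ => fun n _ => FFalse L n
  | FEq _ x y => fun n r => FEq L (r x) (r y)
  | FRel _ R x y => fun n r => FRel R (r x) (r y)
  | FImp _ phi psi => fun n r => FImp (rename phi r) (rename psi r)
  | FAll _ phi => fun n r => FAll (rename phi (scons ord0 (lift ord0 \o r)))
  end.

Lemma sat_rename m (phi : formula L m) n (r : 'I_m -> 'I_n) (v : 'I_n -> M) :
  sat (rename phi r) v <-> sat phi (v \o r).
Proof.
elim: phi n r v => {m} [m|m i j|m R i j|m phi IHphi psi IHpsi|m phi IHphi] n r v //=.
  by rewrite IHphi IHpsi.
have vE a : scons a v \o scons ord0 (lift ord0 \o r) = scons a (v \o r).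
  rewrite scons_comp scons0; congr scons.
  by apply/funext => i /=; rewrite scons_lift.
by split=> phiv a; have := phiv a; rewrite IHphi vE.
Qed.

Definition FNot n (phi : formula L n) := FImp phi (FFalse L n).
Definition FAnd n (phi psi : formula L n) := FNot (FImp phi (FNot psi)).

(** Binds the first [n] variables; it typechecks because [n'.+1 + m] reduces to [(n' + m).+1]. *)
Fixpoint FAlls n m : formula L (n + m) -> formula L m :=
  if n is n'.+1 then fun phi => @FAlls n' m (FAll phi) else id.

Definition FExs n m (phi : formula L (n + m)) := FNot (FAlls (FNot phi)).

Lemma sat_FAnd n (phi psi : formula L n) (v : 'I_n -> M) :
  sat (FAnd phi psi) v <-> sat phi v /\ sat psi v.
Proof.
split=> [/= nn|[phiv psiv] /= /(_ phiv psiv)//].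
by apply: contrapT => /not_andP nand; apply: nn => phiv psiv; case: nand.
Qed.

Lemma sat_FAlls n m (phi : formula L (n + m)) (v : 'I_m -> M) :
  sat (FAlls phi) v <-> forall u : 'I_n -> M, sat phi (join u v).
Proof.
elim: n phi => [|n IHn] phi /=.
  have joinv (u : 'I_0 -> M) : join u v = v.
    by apply/funext => i; rewrite -{1}[i](_ : rshift 0 i = i) ?join_rshift//; apply: val_inj.
  have u0 : 'I_0 -> M by case.
  by split=> [phiv u|/(_ u0)]; rewrite joinv.
rewrite IHn /=; split=> phiv u; last by move=> a; rewrite scons_join.
have -> : u = scons (u ord0) (u \o lift ord0).
  by apply/funext => i; rewrite /scons; case: unliftP => [j|] ->.
by rewrite -scons_join.
Qed.

Lemma sat_FExs n m (phi : formula L (n + m)) (v : 'I_m -> M) :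
  sat (FExs phi) v <-> exists u : 'I_n -> M, sat phi (join u v).
Proof.
rewrite /FExs /= sat_FAlls; split=> [nall|[u phiu] /(_ u phiu)//].
by apply: contrapT => /forallNP nex; apply: nall.
Qed.

(** One literal per pair of indices suffices: an equality, or the unique colour of the edge, which
    by completeness excludes all other colours. The conjunction is therefore finite for any [L]. *)
Lemma qf_type_formula n (w : 'I_n -> M) : complete M ->
  exists theta, forall v : 'I_n -> M, sat theta v <-> same_qf_type w v.
Proof.
move=> cM; pose same (v : 'I_n -> M) (p : 'I_n * 'I_n) :=
  (w p.1 = w p.2 <-> v p.1 = v p.2) /\
  forall R, rel_of R (w p.1) (w p.2) <-> rel_of R (v p.1) (v p.2).
have /choice[lit litE] : forall p, exists phi, forall v, sat phi v <-> same v p.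
  move=> [i j]; have [wij|wij] := pselect (w i = w j).
    exists (FEq L i j) => v; split=> /= [vij|[<-//]]; split=> //= R.
    by rewrite wij vij; split=> h; case: (rel_irrefl h).
  have [R [wR uR]] := cM _ _ wij.
  exists (FRel R i j) => v; split=> /= [vR|[_ /(_ R) /= <-//]].
  have vij : v i <> v j by move=> vij; move: vR; rewrite vij => h; case: (rel_irrefl h).
  have [T [_ uT]] := cM _ _ vij.
  split=> // Q; split=> [/uR <-//|vQ].
  by rewrite -(uT _ vQ) (uT _ vR).
exists (foldr (fun p phi => FAnd (lit p) phi) (FNot (FFalse L n))
  (enum {: 'I_n * 'I_n})) => v.
have -> : same_qf_type w v = forall p, p \in enum {: 'I_n * 'I_n} -> same v p.
  apply/propext; split=> [h p _|h i j]; first exact: h.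
  by apply: (h (i, j)); rewrite mem_enum.
elim: (enum _) => [|p s IHs] /=; first by split.
rewrite -[X in X <-> _]/(sat (FAnd _ _) v) sat_FAnd IHs litE; split.
  by move=> [vp vs] q; rewrite in_cons => /predU1P[->|/vs].
move=> vs; split; first by apply: vs; rewrite mem_head.
by move=> q qs; apply: vs; rewrite in_cons qs orbT.
Qed.

End Formulas.

(** * Weak elimination of imaginaries *)

Section WeakElimination.
Context {L : Type} (M : structure L).
Hypothesis M_complete : complete M.
Hypothesis M_homogeneous : homogeneous M.
Hypothesis M_pstab_setI : forall H (X Y : set M), is_subgroup H ->
  finite_set X -> finite_set Y ->
  pstab X `<=` H -> pstab Y `<=` H -> pstab (X `&` Y) `<=` H.

Lemma weak_elimination : weak_elimination_of_imaginaries M.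
Proof.
move=> n E [[Erefl Esym Etrans] [phi phiE]] x.
have Eaut g y z : automorphism g -> E y z -> E (g \o y) (g \o z).
  by move=> ag; rewrite !phiE -join_comp -sat_automorphism.
(* [H] is the stabiliser of the class of [x]. *)
pose H g := automorphism g /\ E (g \o x) x.
have sH : is_subgroup H.
  split=> [g []//||g h [ag gx] [ah hx]|g h [ag gx] gK hK].
  - by split; [apply: automorphism_id|apply: Erefl].
  - split; first exact: automorphism_comp.
    by apply: Etrans gx; apply: Eaut hx.
  - have ah := automorphism_can ag gK hK; split=> //.
    apply: Esym; rewrite -[X in E X _](_ : h \o (g \o x) = _); first exact: Eaut.
    by apply/funext => i /=; rewrite gK.
have fx : finite_set (range x) by apply: finite_image.
have xH : pstab (range x) `<=` H.
  move=> g [ag gx]; split=> //; rewrite (_ : g \o x = x)//.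
  by apply/funext => i /=; rewrite gx//; exists i.
have [X [Xx XH Xmin]] :=
  minimal_subset (P := fun X => pstab X `<=` H) fx xH.
have fX : finite_set X by apply: sub_finite_set fx.
have [k [c Xc]] := finite_set_enum fX.
pose P z (C : set ('I_n -> M)) :=
  exists2 y, C y & same_qf_type (join c x) (join z y).
have Pdef : definable_eq E P.
  have [theta thetaE] := qf_type_formula (join c x) M_complete.
  (* The variables come in three blocks [u], [z], [y]: [r1] reads [phi] at [(y, u)] and [r2] reads
     [theta] at [(z, u)]. *)
  pose r1 : 'I_(n + n) -> 'I_(n + (k + n)) :=
    join (fun i => rshift n (rshift k i)) (lshift (k + n)).
  pose r2 : 'I_(k + n) -> 'I_(n + (k + n)) :=
    join (fun i => rshift n (lshift n i)) (lshift (k + n)).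
  exists (FExs (FAnd (rename phi r1) (rename theta r2))) => z y.
  have r1E (u : 'I_n -> M) : join u (join z y) \o r1 = join y u.
    by rewrite join_comp; congr join; apply/funext => i /=;
       rewrite ?join_rshift ?join_lshift.
  have r2E (u : 'I_n -> M) : join u (join z y) \o r2 = join z u.
    by rewrite join_comp; congr join; apply/funext => i /=;
       rewrite ?join_rshift ?join_lshift.
  rewrite sat_FExs; split=> [[u yu zu]|[u]].
    by exists u; rewrite sat_FAnd !sat_rename r1E r2E -phiE thetaE.
  by rewrite sat_FAnd !sat_rename r1E r2E -phiE thetaE => -[]; exists u.
have Paut z y : P z (E y) ->
    exists g, [/\ automorphism g, z = g \o c & E y (g \o x)].
  move=> [u yu /(homogeneous_family M_homogeneous)[|g ag gE]].
    exact: finite_image.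
  exists g; split=> //; last rewrite (_ : g \o x = u)//.
    by apply/funext => i; have := gE (lshift n i); rewrite !join_lshift.
  by apply/funext => i; have := gE (rshift k i); rewrite !join_rshift.
have Pc : P c (E x) by exists x.
exists k, c; split; exists P => //; split=> //.
  (* Definable closure: an automorphism fixing [c] fixes [X] pointwise, hence fixes the class of
     [x]. *)
  move=> y /Paut[g [ag cg yg]]; have [_ gx] : H g.
    apply: XH; split=> // u; rewrite Xc => -[i _ <-].
    by rewrite [in RHS]cg.
  have yx : E y x by apply: Etrans gx.
  apply/funext => z; apply/propext; split; last exact: Etrans.
  by apply: Etrans; apply: Esym.
(* Algebraic closure: each conjugate of [c] over the class is [c] reindexed by one of finitely many
   self-maps of the index set. *)
apply: (@sub_finite_set _ _ (range (fun f : {ffun 'I_k -> 'I_k} => c \o f))).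
  move=> z /Paut[g [ag -> xg]].
  have Hg : H g by split=> //; apply: Esym.
  have [h [ah gK hK]] := automorphism_inv ag.
  have Hh : H h by have [_ _ _ Hi] := sH; apply: Hi Hg gK hK.
  (* The intersection property puts the stabiliser of $X\cap hX$ inside [H], so minimality gives
     $X\subseteq hX$. As [h] is the inverse of [g], this says that [g] maps [X] into itself. *)
  have XhX : X `&` h @` X = X.
    apply: Xmin; first by move=> y [].
    by apply: M_pstab_setI => //; [apply: finite_image|apply: pstab_image].
  have gX y : X y -> X (g y).
    by rewrite -{1}XhX => -[_ [u Xu <-]]; rewrite hK.
  have /choice[f fE] : forall i, exists j, c j = g (c i).
    move=> i; have : X (g (c i)) by apply: gX; rewrite Xc; exists i.
    by rewrite Xc => -[j _ cj]; exists j.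
  by exists [ffun i => f i] => //; apply/funext => i /=; rewrite ffunE.
exact: finite_image.
Qed.

End WeakElimination.

(** The first claim asks for [a <> c]: if they coincide, the generated group is just $G_{(aB)}$,
    which may be smaller than $G_{(B)}$. Membership of [a] or [c] in [B] is allowed. *)
Theorem theorem4p5 (L : choiceType) (S : set {mset L}) (pr : seq L)
    (M : structure L)
    (S_triangles : triangles S)
    (pr_uniq : uniq pr) (pr_proper : exists R : L, R \notin pr)
    (S_psf : prioritised_semi_free S pr)
    (M_limit : fraisse_limit S M)
    (S_star : condition_star S pr M) :
  (forall (a c : M) (B : set M), a <> c -> finite_set B ->
     generated (pstab (a |` B) `|` pstab (c |` B)) = pstab B) /\
  intersection_property M /\
  weak_elimination_of_imaginaries M.
Proof.
have meet := limit_pstab_setI S_psf M_limit S_star.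
split; [|split].
- move=> a c B ac fB; apply: generated_pstab_eq => [x|x|H sH]; [by right|by right|].
  exact: (pstab_subU1 S_psf M_limit S_star).
- move=> X Y fX fY; apply: generated_pstab_eq => [x []//|x []//|H sH].
  exact: meet.
- apply: weak_elimination => //; first exact: limit_complete M_limit.
  by case: M_limit.
Qed.
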